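(* Let $a$ be a real number with $a\ne 0$ and let $n$ be a positive integer. Then $$\sum_{k=1}^n\binom{2n}{2k}3^{2k}E_{2n-2k,a}=\frac{2^{2n+1}}{a}+\frac{4(a-1)}{a^2}-\frac{(3a-2)^2}{a^3}E_{2n,a}.$$
   Context: For a real number $a$, the sequence $\{E_{n,a}\}$ is defined by $E_{0,a}=1$ and $E_{n,a}=-a\sum_{k=1}^{\lfloor n/2\rfloor}\binom{n}{2k}E_{n-2k,a}$ for $n\ge 1$. *)

(* Defs.v *)
From mathcomp Require Import all_boot all_order all_algebra.
From mathcomp Require Import reals.

Set Implicit Arguments.
Unset Strict Implicit.
Unset Printing Implicit Defensive.

Import GRing.Theory.
Local Open Scope ring_scope.

(* Given s = [:: E_0; ...; E_(n-1)] with n = size s > 0, the value of E_n. *)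
Definition genEuler_next (R : realType) (a : R) (s : seq R) : R :=
  let n := size s in
  - a * \sum_(1 <= k < (n %/ 2).+1) 'C(n, 2 * k)%:R * s`_(n - 2 * k).

(* The list [:: E_(0,a); ...; E_(n,a)], built up because the recursion is
   course-of-values. The defining recurrence is recovered in genEulerE. *)
Fixpoint genEuler_seq (R : realType) (a : R) (n : nat) : seq R :=
  if n is m.+1 then
    let s := genEuler_seq a m in rcons s (genEuler_next a s)
  else [:: 1].

Definition genEuler (R : realType) (a : R) (n : nat) : R :=
  (genEuler_seq a n)`_n.

Lemma size_genEuler_seq (R : realType) (a : R) (n : nat) :
  size (genEuler_seq a n) = n.+1.
Proof. by elim: n => //= n IHn; rewrite size_rcons IHn. Qed.

Lemma nth_genEuler_seq (R : realType) (a : R) (n i : nat) :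
  (i <= n)%N -> (genEuler_seq a n)`_i = genEuler a i.
Proof.
elim: n => [|n IHn]; first by rewrite leqn0 => /eqP->.
rewrite leq_eqVlt => /predU1P[-> //|lt_in].
by rewrite /= nth_rcons size_genEuler_seq lt_in IHn.
Qed.

Lemma genEuler0 (R : realType) (a : R) : genEuler a 0 = 1.
Proof. by []. Qed.

Lemma genEulerE (R : realType) (a : R) (n : nat) : (0 < n)%N ->
  genEuler a n =
  - a * \sum_(1 <= k < (n %/ 2).+1) 'C(n, 2 * k)%:R * genEuler a (n - 2 * k).
Proof.
case: n => // n _.
rewrite {1}/genEuler /= nth_rcons size_genEuler_seq ltnn eqxx.
rewrite /genEuler_next size_genEuler_seq; congr (_ * _).
apply: eq_big_nat => k /andP[k_gt0 _]; rewrite nth_genEuler_seq //.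
by rewrite -ltnS ltn_subrL muln_gt0 k_gt0.
Qed.

(* Main.v *)
Require Import Defs.
From mathcomp Require Import all_boot all_order all_algebra.
From mathcomp Require Import reals ring.

(** Let [L] be the linear functional on polynomials with [L 'X^i = E_i]. The
    recurrence says [L ((1 - a) p(X) + a (p(X + 1) + p(X - 1)) / 2) = p(0)] for
    [p = 'X^n], hence for every polynomial [p]. With
    [s_j = L ((X + j)^N + (X - j)^N)] and [N = 2n], the choices
    [p = (X + j)^N + (X - j)^N] for [j = 0, 1, 2] express [s_1], [s_2], [s_3]
    through [s_0 = 2 E_N], and the sum to be computed is [s_3 / 2 - E_N]. *)

Import GRing.Theory.
Local Open Scope ring_scope.

(** Odd powers cancel and even powers double; passing from [n] to [n.+1], a new term appears only
    when [n] is odd. *)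
Lemma sum_expr_addN (R : comNzRingType) (c : R) (f : nat -> R) (n : nat) :
  \sum_(i < n.+1) (c ^+ i + (- c) ^+ i) * f i
  = 2 * \sum_(0 <= k < (n %/ 2).+1) c ^+ (2 * k) * f (2 * k)%N.
Proof.
elim: n => [|n IHn].
  by rewrite big_ord_recl big_ord0 big_nat1 muln0 !expr0 /=; ring.
rewrite big_ord_recr /= IHn !divn2 /= uphalf_half exprNn -signr_odd /=.
have [odd_n|even_n] := boolP (odd n); last by rewrite add0n expr1; ring.
have -> : (n.+1 = 2 * n./2.+1)%N.
  by rewrite mul2n doubleS -{1}[n]odd_double_half odd_n.
by rewrite add1n [in RHS]big_nat_recr //= expr0; ring.
Qed.

(* Truncating at degree [M] makes the functional ['X^i |-> e i] linear by a
   mere distribution of sums; it is only meaningful when [size p <= M]. *)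
Definition umbral (R : comNzRingType) (e : nat -> R) (M : nat) (p : {poly R}) : R :=
  \sum_(i < M) p`_i * e i.

Section Umbral.
Variables (R : comNzRingType) (e : nat -> R) (M : nat).
Local Notation L := (umbral R e M).

Lemma umbralZ c p : L (c *: p) = c * L p.
Proof. by rewrite mulr_sumr; apply: eq_bigr => i _; rewrite coefZ mulrA. Qed.

Lemma umbral_sum n (F : 'I_n -> {poly R}) :
  L (\sum_(i < n) F i) = \sum_(i < n) L (F i).
Proof.
rewrite exchange_big; apply: eq_bigr => i _.
by rewrite coef_sum mulr_suml.
Qed.

Lemma umbralXn n : (n < M)%N -> L 'X^n = e n.
Proof.
move=> ltnM; rewrite /umbral (bigD1 (Ordinal ltnM)) //= coefXn eqxx mul1r.
rewrite big1 ?addr0 // => i; rewrite -val_eqE /= coefXn => /negPf->.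
by rewrite mul0r.
Qed.

Lemma umbral_XaddC_exp c n : (n < M)%N ->
  L (('X + c%:P) ^+ n) = \sum_(i < n.+1) c ^+ i * ('C(n, i)%:R * e (n - i)%N).
Proof.
move=> ltnM; rewrite exprDn umbral_sum; apply: eq_bigr => i _.
rewrite -polyC_exp mulrC mul_polyC -scaler_nat !umbralZ umbralXn; first by ring.
exact: leq_ltn_trans (leq_subr _ _) ltnM.
Qed.

(** Symmetrizing in [c] leaves only even indices: [c = 1] yields the sum of the recurrence and
    [c = 3] the sum to be computed, each with an extra term at [k = 0]. *)
Lemma umbral_addN c n : (n < M)%N ->
  L (('X + c%:P) ^+ n) + L (('X + (- c)%:P) ^+ n)
  = 2 * \sum_(0 <= k < (n %/ 2).+1)
          c ^+ (2 * k) * ('C(n, 2 * k)%:R * e (n - 2 * k)%N).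
Proof.
move=> ltnM; rewrite !umbral_XaddC_exp // -big_split /=.
rewrite -(sum_expr_addN R c (fun i => 'C(n, i)%:R * e (n - i)%N)).
by apply: eq_bigr => i _; rewrite mulrDl.
Qed.

Lemma umbral_comp (p q : {poly R}) : (size p <= M)%N ->
  L (p \Po q) = \sum_(i < M) p`_i * L (q ^+ i).
Proof.
move=> lepM; rewrite comp_polyE umbral_sum.
rewrite (big_ord_widen M (fun i => L (p`_i *: q ^+ i))) // big_mkcond /=.
apply: eq_bigr => i _; case: ltnP => [_|lepi]; first exact: umbralZ.
by rewrite nth_default // mul0r.
Qed.

End Umbral.

Section GenEulerFunctional.
Variables (R : realType) (a : R) (M : nat).
Local Notation L := (umbral R (genEuler a) M).

(** The term [k = 0] of the symmetrized sum contributes [2 * a * genEuler a n], cancelling the [- a]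
    in [1 - a]; the rest is the recurrence, or [2] when [n = 0]. *)
Lemma genEuler_functional_Xn n : (n < M)%N ->
  2 * (1 - a) * L 'X^n
    + a * (L (('X + 1%:P) ^+ n) + L (('X + (- 1)%:P) ^+ n))
  = 2 * (n == 0%N)%:R.
Proof.
move=> ltnM; rewrite umbral_addN // umbralXn //.
under eq_bigr do rewrite expr1n mul1r.
rewrite big_nat_recl // muln0 bin0 mul1r subn0.
case: posnP => [->|n_gt0]; first by rewrite big_geq //= genEuler0; ring.
by have := genEulerE a n_gt0; rewrite big_add1 => -> /=; ring.
Qed.

Lemma genEuler_functional (p : {poly R}) : (size p <= M)%N ->
  2 * (1 - a) * L p
    + a * (L (p \Po ('X + 1%:P)) + L (p \Po ('X + (- 1)%:P)))
  = 2 * p.[0].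
Proof.
move=> lepM; rewrite -{1}[p]comp_polyXr !umbral_comp // -big_split /=.
rewrite !mulr_sumr -big_split /= horner_coef0.
transitivity (\sum_(i < M) p`_i * (2 * (i == 0%N :> nat)%:R)).
  apply: eq_bigr => i _; rewrite -genEuler_functional_Xn //.
  by ring.
(* For [M = 0] the size bound forces [p = 0]. *)
case: M lepM => [|m] lepM.
  by rewrite big_ord0 nth_default ?mulr0.
rewrite big_ord_recl big1 => [|i _]; last by rewrite mulr0n !mulr0.
by rewrite /=; ring.
Qed.

(** Take [p = ('X + c%:P) ^+ n] in the functional equation: composing with ['X + d%:P] turns [c]
    into [c + d]. *)
Lemma genEuler_functional_XaddC_exp c n : (n < M)%N ->
  2 * (1 - a) * L (('X + c%:P) ^+ n)
    + a * (L (('X + (c + 1)%:P) ^+ n) + L (('X + (c - 1)%:P) ^+ n))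
  = 2 * c ^+ n.
Proof.
move=> ltnM.
have shift d : (('X + c%:P) ^+ n) \Po ('X + d%:P) = ('X + (c + d)%:P) ^+ n.
  rewrite rmorphXn /= comp_polyD comp_polyX comp_polyC.
  by rewrite polyCD addrAC -addrA.
rewrite -!shift genEuler_functional; first by rewrite !hornerE.
by rewrite -[c]opprK polyCN size_exp_XsubC.
Qed.

End GenEulerFunctional.

Theorem theorem2p4 (R : realType) (a : R) (n : nat)
    (ha : a <> 0) (hn : (0 < n)%N) :
  \sum_(1 <= k < n.+1)
      'C(2 * n, 2 * k)%:R * 3 ^+ (2 * k) * genEuler a (2 * n - 2 * k)
  = 2 ^+ (2 * n + 1) / a + 4 * (a - 1) / a ^+ 2
    - (3 * a - 2) ^+ 2 / a ^+ 3 * genEuler a (2 * n).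
Proof.
have a_neq0 : a != 0 by apply/eqP.
pose N := (2 * n)%N; rewrite -/N.
have ltN : (N < N.+1)%N by [].
(* In this notation [s_j = A j + A (- j)]. *)
pose A c := umbral R (genEuler a) N.+1 (('X + c%:P) ^+ N).
have A_rec c d e : d = c + 1 -> e = c - 1 ->
    2 * (1 - a) * A c + a * (A d + A e) = 2 * c ^+ N.
  by move=> -> ->; exact: genEuler_functional_XaddC_exp.
have A0 : A 0 = genEuler a N by rewrite /A addr0 umbralXn.
have evenN (c : R) : (- c) ^+ N = c ^+ N.
  by rewrite exprNn -signr_odd /N oddM /= mul1r.
have N_gt0 : (0 < N)%N by rewrite muln_gt0.
set S := \sum_(_ <= k < _) _.
have A3 : A 3 + A (- 3) = 2 * (A 0 + S).
  rewrite A0 /A umbral_addN // {1}/N mulKn // big_nat_recl //.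
  rewrite muln0 bin0 expr0 !mul1r subn0 /S big_add1.
  by congr (2 * (_ + _)); apply: eq_bigr => k _; ring.
(* The right-hand side vanishes because [N > 0] gives [0 ^+ N = 0]. *)
have eq0 : 2 * (1 - a) * A 0 + a * (A 1 + A (- 1)) = 0.
  by rewrite (A_rec 0) ?expr0n ?gtn_eqF ?mulr0 //; ring.
have eq1 := A_rec 1 2 0 ltac:(by ring) ltac:(by ring).
have eqN1 := A_rec (- 1) 0 (- 2) ltac:(by ring) ltac:(by ring).
have eq2 := A_rec 2 3 1 ltac:(by ring) ltac:(by ring).
have eqN2 := A_rec (- 2) (- 1) (- 3) ltac:(by ring) ltac:(by ring).
rewrite !evenN expr1n in eq1 eqN1 eq2 eqN2.
have solve u x v : u + a * x = v -> x = (v - u) / a by move=> <-; field.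
have s1 := solve _ _ _ eq0.
(* The instances at [1] and [- 1] both involve [A 0]; their sum is [2 * (1 - a) * s_1 + a * (s_2 + 2
   * A 0) = 4]. *)
have s2 : A 2 + A (- 2) = (4 - 2 * (1 - a) * (A 1 + A (- 1))) / a - 2 * A 0.
  apply/eqP; rewrite -subr_eq opprK; apply/eqP/solve.
  by transitivity (2 * 1 + 2 * 1 : R); [rewrite -{1}eq1 -eqN1 | ]; ring.
(* Likewise, the instances at [2] and [- 2] add up to [2 * (1 - a) * s_2 + a * (s_3 + s_1) = 4 * 2
   ^+ N]. *)
have s3 : A 3 + A (- 3)
    = (4 * 2 ^+ N - 2 * (1 - a) * (A 2 + A (- 2))) / a - (A 1 + A (- 1)).
  apply/eqP; rewrite -subr_eq opprK; apply/eqP/solve.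
  by transitivity (2 * 2 ^+ N + 2 * 2 ^+ N : R); [rewrite -{1}eq2 -eqN2 | ]; ring.
have -> : S = (A 3 + A (- 3)) / 2 - A 0 by rewrite A3; field.
rewrite s3 s2 s1 -A0 exprD expr1.
by field.
Qed.
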